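(* Let $(\delta_n)$ be a sequence of positive reals with $\delta_n\sqrt{\log n}\to0$ as $n\to\infty$, and let $f_n:[0,1]\to\mathbb R$ be given by $f_n(x)=\delta_n$ if $x\in[1/3,2/3)$ and $f_n(x)=0$ otherwise. For each $n$ let $Y_i=f_n(i/n)+\epsilon_i$, $i=1,\dots,n$, where $\epsilon_1,\dots,\epsilon_n$ are i.i.d. standard normal $\mathcal N(0,1)$ random variables. Then for every sequence $(q_n)$ of real numbers, $$\limsup_{n\to\infty}\mathbb P\left(k^\infty_{q_n}(Y^{(n)})=1\right)<1 .$$
   Context: Number of modes: for $g:[0,1]\to\mathbb R$ and a partition $P$: $0=t_0<\dots<t_N=1$, let $M(g,P)$ be the number of indices $0<i<N$ with $\max(g(t_{i-1}),g(t_{i+1}))<g(t_i)$, and $M(g)=\sup_PM(g,P)$ over all finite partitions. For $n\ge1$ let $PC_n$ be the set of functions $g:[0,1]\to\mathbb R$ that are constant on each open interval $\left(\frac{i-1}n,\frac in\right)$, $i=1,\dots,n$, whose value at each interior grid point $\frac in$, $1\le i\le n-1$, is the average of the values on the two adjacent intervals, and whose values at $0$ and $1$ equal the value on the adjacent interval. $Y^{(n)}\in PC_n$ is the function with value $Y_i$ on $\left(\frac{i-1}n,\frac in\right)$. The sup norm (persistence) signatures of $g\in PC_n$ are $s_{j,\infty}(g)=\inf\{\sup_{x\in[0,1]}|g(x)-h(x)| : h\in PC_n,\ M(h)\le j\}$ for $j\in\mathbb N_0$, with the convention $s_{-1,\infty}(g)=\infty$. For $q\in\mathbb R$ let $k^\infty_q(g)=\max\{j\in\mathbb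 N_0: s_{j-1,\infty}(g)\ge q\}$ (equal to $\infty$ if the set is unbounded). *)

(* Defs.v *)
From HB Require Import structures.
From mathcomp Require Import all_boot all_order all_algebra archimedean finmap.
From mathcomp Require Import all_classical all_reals all_analysis.
From mathcomp Require Import ring lra.

Set Implicit Arguments.
Unset Strict Implicit.
Unset Printing Implicit Defensive.

Import Order.TTheory GRing.Theory Num.Theory.
Import numFieldNormedType.Exports.

Local Open Scope classical_set_scope.
Local Open Scope ring_scope.

(* Functions [0, 1] -> R are represented by total functions R -> R, of which
   only the values on `[0, 1] are ever used. *)

Section modes.
Context {R : realType}.
Implicit Types (g h : R -> R) (v : nat -> R).

(* A partition 0 = t_0 < ... < t_N = 1 is given by [s] = [t_1; ...; t_N] with
   [itv_partition 0 1 s], so N = size s and t_i = nth 0 (0 :: s) i. *)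
Definition modes_on g (s : seq R) : nat :=
  let t i := nth 0 (0 :: s) i in
  (\sum_(1 <= i < size s |
      (Num.max (g (t i.-1)) (g (t i.+1)) < g (t i))%R) 1)%N.

Definition modes g : \bar R :=
  ereal_sup [set (modes_on g s)%:R%:E | s in itv_partition (0 : R) 1].

(* The cells are numbered 1, ..., n, the i-th one being ](i - 1)/n, i/n[. *)
Definition has_steps (n : nat) v g : Prop :=
  [/\ forall i, (1 <= i <= n)%N ->
        forall x, i.-1%:R / n%:R < x < i%:R / n%:R -> g x = v i,
      forall i, (1 <= i < n)%N -> g (i%:R / n%:R) = (v i + v i.+1) / 2,
      g 0 = v 1%N
    & g 1 = v n].

Definition PC (n : nat) : set (R -> R) := [set g | exists v, has_steps n v g].

(* The average of the values on the cells immediately to the left and to the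
   right of x (the same cell when x is not a grid point), where the cell
   numbers are clamped to 1, ..., n at the endpoints 0 and 1. *)
Definition step_fun (n : nat) v : R -> R := fun x =>
  (v (maxn 1 `|Num.ceil (n%:R * x)|%N)
   + v (minn n (Num.truncn (n%:R * x)).+1)) / 2.

Lemma step_funP (n : nat) v : (0 < n)%N -> has_steps n v (step_fun n v).
Proof.
move=> n0; have nR : (0 : R) < n%:R by rewrite ltr0n.
have avg (a : R) : (a + a) / 2 = a by field.
have grid i : n%:R * (i%:R / n%:R) = i%:R :> R.
  by rewrite mulrC divfK// gt_eqF.
have ceil_nat i : `|Num.ceil (i%:R : R)|%N = i by rewrite pmulrn intrKceil.
split.
- move=> [//|i] /andP[_ le_in] x; rewrite /= ltr_pdivrMr// ltr_pdivlMr//.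
  rewrite [x * _]mulrC => /andP[lt_ix lt_xi].
  rewrite /step_fun; have -> : Num.truncn (n%:R * x) = i.
    by apply: truncn_def; rewrite lt_xi ltW.
  have -> : Num.ceil (n%:R * x) = i.+1%:Z.
    by apply: ceil_def; rewrite -addn1 PoszD addrK/= -!pmulrn addn1
      lt_ix (ltW lt_xi).
  by rewrite (minn_idPr le_in) (maxn_idPr _)// avg.
- move=> i /andP[i1 lt_in]; rewrite /step_fun grid ceil_nat natrK.
  by rewrite (maxn_idPr i1) (minn_idPr lt_in).
- rewrite /step_fun mulr0 (ceil_nat 0%N) (natrK 0%N) maxn0.
  by rewrite (minn_idPr n0) avg.
- rewrite /step_fun mulr1 ceil_nat natrK (maxn_idPr n0) (minn_idPl (leqnSn n)).
  by rewrite avg.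
Qed.

Definition sup_dist g h : \bar R :=
  ereal_sup [set `|g x - h x|%:E | x in `[0, 1]].

Definition signature (n : nat) g (j : nat) : \bar R :=
  ereal_inf [set sup_dist g h | h in PC n `&` [set h | (modes h <= j%:R%:E)%E]].

(* s_(j - 1), with s_(-1) = +oo *)
Definition signature_pred (n : nat) g (j : nat) : \bar R :=
  if j is j'.+1 then signature n g j' else +oo%E.

(* The supremum of a set of naturals containing 0 is its maximum if it is
   bounded, and +oo otherwise. *)
Definition mode_count (n : nat) (q : R) g : \bar R :=
  ereal_sup [set j%:R%:E | j in [set j | (q%:E <= signature_pred n g j)%E]].

Definition bump_signal (delta x : R) : R :=
  if 1 / 3 <= x < 2 / 3 then delta else 0.

End modes.

Section noise.
Context d (T : measurableType d) (R : realType) (P : probability T R).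

Definition mutually_independent (I : choiceType) (J : set I)
    (X : I -> {RV P >-> R}) : Prop :=
  forall F : {fset I}, [set` F] `<=` J ->
  forall B : I -> set R, (forall i, measurable (B i)) ->
    P (\bigcap_(i in [set` F]) (X i @^-1` B i)) =
    (\prod_(i <- F) P (X i @^-1` B i))%E.

Definition standard_normal (X : {RV P >-> R}) : Prop :=
  forall B : set R, measurable B -> distribution P X B = normal_prob 0 1 B.

End noise.

(* Main.v *)
(* Idea. The theorem's event is [q <= s_0 and s_1 < q].  Let [b] be the multiple
   of [delta] at which the Gaussian tail first drops below [400 / n].
   - If [2 q >= 2 b + delta], then with probability at least [expR (- 1600)] all
     noise variables lie in ]-b, b[, so the constant [delta / 2] is closer than
     [q] to the data and [s_0 < q].
   - If [2 q < 2 b + delta], split the sample into five consecutive blocks. With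
     probability at least 1/2 the noise goes below [- (b + 2 delta)] in the
     blocks 1, 3, 5 and above [b + 2 delta] in the blocks 2, 4; then every
     function closer than [q] to the data has two modes, so [s_1 >= q].
   The second case uses that a shift by [O(delta)] costs only a constant factor
   in a Gaussian tail up to level [O(sqrt (ln n))]: this is where
   [delta * sqrt (ln n) --> 0] enters.  No property of the signal is used except
   that its values lie in [0, delta]. *)
Require Import Defs.
From HB Require Import structures.
From mathcomp Require Import all_boot all_order all_algebra archimedean finmap.
From mathcomp Require Import all_classical all_reals all_analysis.
From mathcomp Require Import ring lra zify measurable_realfun.

Set Implicit Arguments.
Unset Strict Implicit.
Unset Printing Implicit Defensive.

Import Order.TTheory GRing.Theory Num.Theory.
Import numFieldNormedType.Exports.

Local Open Scope classical_set_scope.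
Local Open Scope ring_scope.

(** * Tails of the standard normal law: reflection, shifts and the exponential bound *)

Section normal_tail.
Context {R : realType}.
Implicit Types x y s a u : R.

Let continuous_pdf : continuous (@normal_pdf R 0 1).
Proof. by apply: continuous_normal_pdf; exact: oner_neq0. Qed.

Lemma normal_pdf_opp x : normal_pdf 0 1 (- x) = normal_pdf 0 1 x.
Proof. by rewrite !normal_pdfE ?oner_neq0// /normal_fun !subr0 sqrrN. Qed.

Lemma normal_pdf_shift x s :
  normal_pdf 0 1 (x + s) = normal_pdf 0 1 x * expR (- (x * s + s ^+ 2 / 2)).
Proof.
rewrite !normal_pdfE ?oner_neq0// -mulrA /normal_fun -expRD !subr0.
by congr (_ * expR _); field.
Qed.

Lemma normal_prob_reflect x :
  normal_prob 0 1 `]-oo, - x] = normal_prob 0 1 `[x, +oo[.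
Proof.
rewrite /normal_prob ge0_integration_by_substitutionNy//.
- by apply: eq_integral => y _ /=; rewrite normal_pdf_opp.
- exact: continuous_subspaceT.
- by move=> y _; exact: normal_pdf_ge0.
Qed.

(** Pulling the shift into the integrand puts both tails on one half-line, where they can be
    compared pointwise. *)
Lemma normal_prob_shift x s : normal_prob 0 1 `[x + s, +oo[ =
  (\int[lebesgue_measure]_(y in `[x, +oo[) (normal_pdf 0 1 (y + s))%:E)%E.
Proof.
have Dshift : (fun y => y + s)^`()%classic = cst (1 : R).
  by apply/funext => z; rewrite derive1E derive_val addr0.
rewrite /normal_prob (@increasing_ge0_integration_by_substitutiony _ (fun y => y + s)).
- by apply: eq_integral => y _; rewrite fctE Dshift mulr1.
- by move=> y z _ _; rewrite ltrD2r.
- by rewrite Dshift => ? _; exact: cst_continuous.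
- by rewrite Dshift; exact: is_cvg_cst.
- by rewrite Dshift; exact: is_cvg_cst.
- split=> //; apply: cvg_at_right_filter.
  by apply: cvgD; [exact: cvg_id|exact: cvg_cst].
- exact: cvg_addrr.
- exact: continuous_subspaceT.
- by move=> y _; exact: normal_pdf_ge0.
Qed.

Let measurable_pdf (D : set R) : measurable_fun D (EFin \o normal_pdf 0 1).
Proof.
by apply/measurable_EFinP/measurable_funTS; exact: measurable_normal_pdf.
Qed.

Let measurable_pdf_shift s (D : set R) :
  measurable_fun D (fun y : R => (normal_pdf 0 1 (y + s))%:E : \bar R).
Proof.
apply/measurable_EFinP/measurable_funTS/(measurableT_comp (measurable_normal_pdf 0 1)).
exact: measurable_funD.
Qed.

Let measurable_scale_pdf_shift c s (D : set R) :
  measurable_fun D (fun y : R => (c%:E * (normal_pdf 0 1 (y + s))%:E)%E : \bar R).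
Proof. exact: (emeasurable_funM (measurable_cst c%:E) (@measurable_pdf_shift s D)). Qed.

Let measurable_scale_pdf c (D : set R) :
  measurable_fun D (fun y : R => (c%:E * (normal_pdf 0 1 y)%:E)%E : \bar R).
Proof. exact: (emeasurable_funM (measurable_cst c%:E) (@measurable_pdf D)). Qed.

(** For [y >= 0] the density at [y + u] is at most [expR (- (u ^+ 2 / 2))] times the density at [y],
    whose total mass is at most 1. *)
Lemma normal_prob_tail_le u : 0 <= u ->
  (normal_prob 0 1 `[u, +oo[ <= (expR (- (u ^+ 2 / 2)))%:E)%E.
Proof.
move=> u0; rewrite -[in `[u, +oo[](add0r u) normal_prob_shift.
have e0 : 0 <= expR (- (u ^+ 2 / 2)) by exact: expR_ge0.
apply: (@le_trans _ _ (\int[lebesgue_measure]_(y in `[0%R, +oo[)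
    ((expR (- (u ^+ 2 / 2)))%:E * (normal_pdf 0 1 y)%:E))%E).
  apply: ge0_le_integral => //=.
  - by move=> y _; rewrite lee_fin normal_pdf_ge0.
  - exact: measurable_pdf_shift.
  - exact: measurable_scale_pdf.
  - move=> y; rewrite in_itv/= andbT => y0.
    rewrite -EFinM lee_fin normal_pdf_shift mulrC ler_wpM2r ?normal_pdf_ge0//.
    by rewrite ler_expR lerN2 lerDr mulr_ge0.
rewrite ge0_integralZl//=; first last.
- by move=> y _; rewrite lee_fin normal_pdf_ge0.
- exact: measurable_pdf.
rewrite -[leRHS]mule1 lee_pmul2l//; last by rewrite lte_fin expR_gt0.
exact: (@probability_le1 _ _ _ (@normal_prob R 0 1)).
Qed.

(** The ratio of the densities at [y] and [y + s] is [expR (y * s + s ^+ 2 / 2)], which is unbounded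
    in [y] when [s > 0]. Hence the cutoff [u]: below it the ratio is controlled, and the mass above
    it is kept as a separate term. *)
Lemma normal_prob_tail_ratio a u s : 0 <= s ->
  (normal_prob 0 1 `[a, +oo[ <= normal_prob 0 1 `[u, +oo[ +
    (expR (u * s + s ^+ 2 / 2))%:E * normal_prob 0 1 `[(a + s)%R, +oo[)%E.
Proof.
move=> s0.
have : (normal_prob (0 : R) 1 `[a, +oo[ <=
    normal_prob (0:R) 1 `[u, +oo[ + normal_prob (0:R) 1 (`[a, +oo[ `&` `]-oo, u[))%E.
  rewrite [leRHS]addeC.
  apply: le_trans (measureU2 _ _ _) => //=; last exact: measurableI.
  apply: le_measure; rewrite ?inE//=.
    by apply: measurableU => //; exact: measurableI.
  by move=> y /= ay; have [yu|yu] := ltP y u; [left; split=> //=|right];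
    rewrite in_itv/= ?andbT.
move/le_trans; apply; apply: leeD => //.
rewrite normal_prob_shift.
rewrite -ge0_integralZl//=; first last.
- by move=> y _; rewrite lee_fin normal_pdf_ge0.
- exact: measurable_pdf_shift.
apply: (@le_trans _ _ (\int[lebesgue_measure]_(y in `[a, +oo[ `&` `]-oo, u[)
   ((expR (u * s + s ^+ 2 / 2))%:E * (normal_pdf 0 1 (y + s))%:E))%E).
  apply: ge0_le_integral => //=.
  - exact: measurableI.
  - by move=> y _; rewrite lee_fin normal_pdf_ge0.
  - exact: measurable_pdf.
  - exact: measurable_scale_pdf_shift.
  - move=> y [_]; rewrite /= in_itv/= => yu.
    rewrite -EFinM lee_fin normal_pdf_shift mulrCA -expRD ler_peMr ?normal_pdf_ge0//.
    by rewrite -[leLHS]expR0 ler_expR; nra.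
apply: ge0_subset_integral => //=.
- exact: measurableI.
- exact: measurable_scale_pdf_shift.
- by move=> y _; rewrite mule_ge0 ?lee_fin ?expR_ge0 ?normal_pdf_ge0.
Qed.

Lemma normal_prob_ge0_half : ((2^-1)%:E <= @normal_prob R 0 1 `[0%R, +oo[)%E.
Proof.
set p := normal_prob 0 1 _.
have pfin : p \is a fin_num by apply: (fin_num_measure (@normal_prob R 0 1)).
have : (1 <= p + p)%E.
  rewrite {1}/p -normal_prob_reflect oppr0.
  rewrite -(@probability_setT _ _ _ (@normal_prob R 0 1)).
  apply: le_trans (measureU2 _ _ _) => //=.
  apply: le_measure; rewrite ?inE//=; first exact: measurableU.
  by move=> y _ /=; rewrite !in_itv/= andbT; have [|/ltW] := leP y 0; [left|right].
rewrite -(fineK pfin) -EFinD !lee_fin; lra.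
Qed.

End normal_tail.

(** * A noise level whose tail is of order [1 / n], stable under small shifts *)

Section normal_level.
Context {R : realType}.
Implicit Types x y : R.

Local Notation tail x := (@normal_prob R 0 1 `[x%R, +oo[).

Lemma le_normal_tail x y : x <= y -> (tail y <= tail x)%E.
Proof.
move=> xy; apply: le_measure; [apply: mem_set; exact: measurable_itv|apply: mem_set; exact: measurable_itv|].
move=> z /=; rewrite !in_itv/= !andbT; exact: le_trans xy.
Qed.

Lemma ln_nat_ge1 n : (4 <= n)%N -> 1 <= ln (n%:R : R).
Proof.
move=> n4; have n0 : 0 < n%:R :> R by rewrite ltr0n (leq_trans _ n4).
(* It suffices that [expR 1 <= 4]; this follows from [expR (1 / 2) <= 2], a consequence of
   [1 + x <= expR x] at [x = - 1 / 2]. *)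
rewrite -ler_expR lnK ?posrE//.
have h : expR (2^-1 : R) <= 2.
  have := expR_ge1Dx (- 2^-1 : R); rewrite expRN => h.
  have := expR_gt0 (2^-1 : R) => h0.
  have : 2^-1 <= (expR (2^-1 : R))^-1 by lra.
  by rewrite lef_pV2 ?posrE.
have -> : 1 = 2^-1 + 2^-1 :> R by field.
rewrite expRD; apply: (@le_trans _ _ (2%:R * 2%:R)).
  by rewrite ler_pM// expR_ge0.
have n4R : (4%:R : R) <= n%:R by rewrite ler_nat.
lra.
Qed.

(* At the grid point just before [b] the tail still exceeds [400 / n]; this and
   the tail ratio bound, with cutoff [u = 2 sqrt (ln n)] and shift [3 delta],
   give the lower bound. *)
Lemma normal_level (n : nat) (delta : R) : (800 < n)%N -> 0 < delta ->
  delta * Num.sqrt (ln n%:R) <= 100^-1 ->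
  exists b : R, [/\ (tail b <= (400 / n%:R)%:E)%E &
    ((180 / n%:R)%:E <= tail (b + 2 * delta))%E].
Proof.
move=> n800 d0 dn; have n0 : 0 < n%:R :> R by rewrite ltr0n (leq_trans _ n800).
have lnn : 1 <= ln (n%:R : R) by apply/ln_nat_ge1/(leq_trans _ n800).
(* Here [expR (- (u ^+ 2 / 2))] is [n ^- 2], so the mass beyond the cutoff is negligible against
   [400 / n]. *)
set u := 2 * Num.sqrt (ln (n%:R : R)).
have su : 1 <= Num.sqrt (ln (n%:R : R)) by rewrite -[leLHS]sqrtr1 ler_wsqrtr.
have tailu : (tail u <= (n%:R^-1)%:E)%E.
  apply: le_trans (normal_prob_tail_le _) _; first by rewrite /u; lra.
  rewrite lee_fin -[leRHS]lnK ?posrE ?invr_gt0// ler_expR lnV ?posrE// lerN2.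
  by rewrite /u exprMn sqr_sqrtr; lra.
have ex_k : exists k : nat, (tail (k%:R * delta) <= (400 / n%:R)%:E)%E.
  exists (Num.truncn (u / delta)).+1.
  apply: (@le_trans _ _ (tail u)).
    by apply: le_normal_tail; rewrite -ler_pdivrMr// ltW// truncnS_gt.
  apply: le_trans tailu _; rewrite lee_fin ler_peMl ?invr_ge0 ?ltW//.
  by lra.
(* The minimal index is not 0: the tail at 0 is at least 1/2, and [400 / n < 1 / 2]. *)
case: (ex_minnP ex_k) => -[|k] tk kmin.
  exfalso; move: tk; rewrite mul0r; apply/negP; rewrite -ltNge.
  apply: lt_le_trans normal_prob_ge0_half; rewrite lte_fin.
  rewrite ltr_pdivrMr//.
  have : 800%:R < n%:R :> R by rewrite ltr_nat.
  lra.
exists (k.+1%:R * delta); split=> //.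
have tk' : ((400 / n%:R)%:E < tail (k%:R * delta))%E.
  by rewrite ltNge; apply/negP => /kmin; rewrite ltnn.
have d3 : 0 <= 3 * delta by lra.
have := normal_prob_tail_ratio (k%:R * delta) u d3.
have -> : k%:R * delta + 3 * delta = k.+1%:R * delta + 2 * delta.
  by rewrite -[in RHS]natr1; ring.

set t := tail (k.+1%:R * delta + _).
have tfin : t \is a fin_num by exact: (fin_num_measure (@normal_prob R 0 1)).
move=> /(lt_le_trans tk') h.
(* The exponent [u * (3 * delta) + (3 * delta) ^+ 2 / 2] is below 1/2 by the smallness of [delta],
   so the factor is at most 2. The conclusion [t > 199.5 / n] is more than enough. *)
have : ((400 / n%:R)%:E < (n%:R^-1)%:E + 2%:E * t)%E.
  apply: lt_le_trans h _; apply: leeD => //.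
  apply: lee_wpmul2r; first exact: measure_ge0.
  rewrite lee_fin.
  have : expR (u * (3 * delta) + (3 * delta) ^+ 2 / 2) <= expR (2^-1 : R).
    rewrite ler_expR /u.
    have d1 : delta <= 100^-1 by nra.
    nra.
  move=> /le_trans; apply.
  have := expR_ge1Dx (- 2^-1 : R); rewrite expRN => h.
  rewrite -[leRHS]invrK -[leLHS]invrK lef_pV2 ?posrE ?invr_gt0 ?expR_gt0//.
  lra.
rewrite -(fineK tfin) -EFinM -EFinD lte_fin lee_fin.
have : 0 < n%:R^-1 :> R by rewrite invr_gt0.
by move: (n%:R^-1) => x; lra.
Qed.
End normal_level.

(** * Step functions, signatures and modes in terms of the cell values *)

Section steps.
Context {R : realType}.
Implicit Types (g h : R -> R) (v z : nat -> R).

(** The cells [i] and [j] depend on [x] alone, so one pair serves two step functions at once. *)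
Lemma has_steps_eval n (x : R) : (0 < n)%N -> 0 <= x <= 1 ->
  exists i j, [/\ (1 <= i <= n)%N, (1 <= j <= n)%N &
    forall v g, has_steps n v g -> g x = (v i + v j) / 2].
Proof.
move=> n0 /andP[x0 x1]; have nR : (0 : R) < n%:R by rewrite ltr0n.
have avg (a : R) : a = (a + a) / 2 by field.
have [->|xn0] := eqVneq x 0.
  by exists 1%N, 1%N; split=> // v g []; rewrite -avg.
have [->|xn1] := eqVneq x 1.
  by exists n, n; split; rewrite ?n0 ?leqnn// => v g []; rewrite -avg.
have {}x0 : 0 < x by rewrite lt_neqAle eq_sym xn0.
have {}x1 : x < 1 by rewrite lt_neqAle xn1.
have nx0 : 0 <= n%:R * x by rewrite mulr_ge0// ltW.
set m := Num.truncn (n%:R * x).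
have /andP[mx xm] := truncn_itv nx0; rewrite -/m in mx xm.
have mn : (m < n)%N.
  by rewrite -(ltr_nat R) (le_lt_trans mx)// gtr_pMr.
have xE : x = (n%:R * x) / n%:R by rewrite mulrC mulKf// gt_eqF.
have [xmE|xnm] := eqVneq (n%:R * x) m%:R.
  have m0 : (0 < m)%N by rewrite -(ltr_nat R) -xmE mulr_gt0.
  exists m, m.+1; rewrite m0 mn ltnW//; split=> // v g [_ + _ _].
  by move=> /(_ m); rewrite m0 mn => /(_ isT); rewrite -xmE -xE.
exists m.+1, m.+1; rewrite mn; split=> // v g [+ _ _ _] => /(_ m.+1).
rewrite /= mn => /(_ isT x) ->; first exact: avg.
rewrite ltr_pdivrMr// ltr_pdivlMr// ![x * _]mulrC xm andbT.
by rewrite lt_neqAle eq_sym xnm.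
Qed.

Definition cell_mid (n i : nat) : R := (i%:R - 2^-1) / n%:R.

Lemma cell_mid_itv n i : (1 <= i <= n)%N -> 0 < cell_mid n i < 1.
Proof.
move=> /andP[i1 i_n]; have n0 : (0 < n)%N by exact: leq_trans i_n.
have i1R : 1 <= i%:R :> R by rewrite ler1n.
have inR : i%:R <= n%:R :> R by rewrite ler_nat.
by rewrite /cell_mid divr_gt0 ?ltr0n//=; [rewrite ltr_pdivrMr ?ltr0n//; lra|lra].
Qed.

Lemma ltr_cell_mid n i j : (0 < n)%N -> (i < j)%N -> cell_mid n i < cell_mid n j.
Proof. by move=> n0 ij; rewrite ltr_pM2r ?invr_gt0 ?ltr0n// ltrD2r ltr_nat. Qed.

Lemma has_steps_mid n v g i : has_steps n v g -> (1 <= i <= n)%N ->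
  g (cell_mid n i) = v i.
Proof.
move=> [+ _ _ _] i1n => /(_ i i1n); apply.
case: i i1n => [//|i] /andP[_ i_n]; have n0 : (0 < n)%N by exact: leq_trans i_n.
rewrite /cell_mid /= -natr1 !ltr_pM2r ?invr_gt0 ?ltr0n//; lra.
Qed.

(** Cell midpoints recover the cell values; conversely, the difference at any point is the average
    of two cell differences. *)
Lemma sup_dist_lt n v z g h (q : R) : (0 < n)%N ->
  has_steps n v g -> has_steps n z h ->
  (sup_dist g h < q%:E)%E <->
  (forall i, (1 <= i <= n)%N -> `|v i - z i| < q).
Proof.
move=> n0 vg zh; split=> [gh i i1n|vz].
  rewrite -(has_steps_mid vg i1n) -(has_steps_mid zh i1n) -lte_fin.
  apply: le_lt_trans gh; apply: ereal_sup_ubound; exists (cell_mid n i) => //=.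
  by rewrite in_itv/=; have /andP[/ltW-> /ltW->] := cell_mid_itv i1n.
(* A maximum over finitely many cells keeps the inequality strict under the supremum. *)
pose M := \big[Num.max/0]_(i < n) `|v i.+1 - z i.+1|.
have vzM i : (1 <= i <= n)%N -> `|v i - z i| <= M.
  by case: i => [//|i] /andP[_ i_n]; exact: (le_bigmax _ _ (Ordinal i_n)).
have q0 : 0 < q by apply: le_lt_trans (vz 1%N _) => //; rewrite n0.
apply: (@le_lt_trans _ _ M%:E); last first.
  by rewrite lte_fin; apply/bigmax_ltP; split=> // i _; apply: vz => /=.
apply: ge_ereal_sup => _ [x /= x01 <-]; rewrite lee_fin.
move: x01; rewrite in_itv/= => /(has_steps_eval n0)[i [j [i1n j1n e]]].
rewrite (e v g vg) (e z h zh).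
have -> : (v i + v j) / 2 - (z i + z j) / 2 = ((v i - z i) + (v j - z j)) / 2 by field.
rewrite normrM [X in _ * X]ger0_norm ?invr_ge0// ler_pdivrMr//.
apply: le_trans (ler_normD _ _) _.
by have := vzM _ i1n; have := vzM _ j1n; lra.
Qed.

(** With a strict inequality the infimum need not be attained: it lies below [q] as soon as one
    competitor does. *)
Lemma signature_lt n v (q : R) j : (0 < n)%N ->
  (signature n (step_fun n v) j < q%:E)%E <->
  exists2 z, (exists2 h, has_steps n z h & (modes h <= j%:R%:E)%E) &
    forall i, (1 <= i <= n)%N -> `|v i - z i| < q.
Proof.
move=> n0; have vg := @step_funP R n v n0; split.
  move=> /ereal_inf_lt[_ [h [[z zh] hj] <-]] ghq.
  by exists z; [exists h|exact/(sup_dist_lt _ n0 vg zh)].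
move=> [z [h zh hj]] /(sup_dist_lt _ n0 vg zh); apply: le_lt_trans.
by apply: ereal_inf_lbound; exists h => //; split=> //; exists z.
Qed.

Lemma signature_anti n g i j : (i <= j)%N -> (signature n g j <= signature n g i)%E.
Proof.
move=> ij; apply: le_ereal_inf => _ [h [hn hi] <-]; exists h => //; split=> //.
by apply: le_trans hi _; rewrite lee_fin ler_nat.
Qed.

(** Signatures decrease in [j], so the admissible indices form an initial segment; its supremum is 1
    when it contains 1 but not 2. *)
Lemma mode_count_eq1 n (q : R) g : mode_count n q g = 1%E <->
  ~ (signature n g 0 < q%:E)%E /\ (signature n g 1 < q%:E)%E.
Proof.
split=> [mc1|[/negP]]; last first.
  rewrite -leNgt => q0 q1; apply/eqP; rewrite eq_le; apply/andP; split.
    apply: ge_ereal_sup => _ [[|[|j]] /= qj <-]; rewrite ?lee_fin//.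
    have := lt_le_trans q1 qj; rewrite ltNge.
    by rewrite (signature_anti n g (isT : 1 <= j.+1)%N).
  by apply: ereal_sup_ubound; exists 1%N.
split.
  move=> q0; have : (mode_count n q g <= 0)%E.
    apply: ge_ereal_sup => _ [[|j] /= qj <-]; rewrite ?lee_fin//.
    have := lt_le_trans q0 qj; rewrite ltNge.
    by rewrite (signature_anti n g (leq0n j)).
  by rewrite mc1 lee_fin ler10.
rewrite ltNge; apply/negP => q1.
have : (2%:R%:E <= mode_count n q g)%E by apply: ereal_sup_ubound; exists 2%N.
by rewrite mc1 lee_fin; lra.
Qed.

Lemma modes_cst (c : R) : modes (fun=> c) = 0%E.
Proof.
have z s : modes_on (fun=> c) s = 0%N.
  by rewrite /modes_on; apply: big1_seq => i; rewrite maxxx ltxx.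
apply/eqP; rewrite eq_le; apply/andP; split.
  by apply: ge_ereal_sup => _ [s _ <-]; rewrite z.
(* The one-step partition shows that the supremum is over a nonempty set, hence 0 and not [-oo]. *)
apply: ereal_sup_ubound; exists [:: 1]; last by rewrite z.
by split; rewrite /= ?ltr01 ?eqxx.
Qed.

Lemma has_steps_cst n (c : R) : has_steps n (fun=> c) (fun=> c).
Proof. by split=> // *; field. Qed.

Lemma modes_two n z h i1 i2 i3 i4 i5 : has_steps n z h ->
  (0 < i1 < i2)%N -> (i2 < i3 < i4)%N -> (i4 < i5 <= n)%N ->
  Num.max (z i1) (z i3) < z i2 -> Num.max (z i3) (z i5) < z i4 ->
  (2%:R%:E <= modes h)%E.
Proof.
move=> zh /andP[i1_gt0 i12] /andP[i23 i34] /andP[i45 i5n] h2 h4.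
have n0 : (0 < n)%N by lia.
have [r1 [r2 [r3 [r4 r5]]]] : (1 <= i1 <= n)%N /\ (1 <= i2 <= n)%N /\
  (1 <= i3 <= n)%N /\ (1 <= i4 <= n)%N /\ (1 <= i5 <= n)%N by lia.
pose s : seq R := [:: cell_mid n i1; cell_mid n i2; cell_mid n i3; cell_mid n i4;
  cell_mid n i5; 1].
have sP : itv_partition 0 1 s.
  split=> //=; rewrite !ltr_cell_mid//.
  by have /andP[-> _] := cell_mid_itv r1; have /andP[_ ->] := cell_mid_itv r5.
apply: (@le_trans _ _ (modes_on h s)%:R%:E); last first.
  by apply: ereal_sup_ubound; exists s.
(* The partition points are 0, the five midpoints and 1. Indices 2 and 4 are modes by [h2] and [h4];
   the other interior indices can only add to the count. *)
rewrite lee_fin ler_nat /modes_on big_mkcond /=.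
rewrite 5?big_nat_recl//= big_geq//.
rewrite !(has_steps_mid zh)// h2 h4.
lia.
Qed.

End steps.

(* The set is a union of open boxes, possibly uncountable; shrinking them makes
   it a countable union of boxes with rational centers and radii [1 / k.+1]. *)
Lemma measurable_sup_nbhs d (T : measurableType d) (R : realType)
    (X : nat -> T -> R) (n : nat) (S : set (nat -> R)) (q : R) :
  (forall i, (1 <= i <= n)%N -> measurable_fun setT (X i)) ->
  measurable [set w | exists2 z, S z &
    forall i, (1 <= i <= n)%N -> `|X i w - z i| < q].
Proof.
move=> mX.
pose box (tk : seq rat * nat) := [set w : T | forall i, (1 <= i <= n)%N ->
  `|X i w - ratr (nth 0 tk.1 i)| < tk.2.+1%:R^-1].
pose I := [set tk : seq rat * nat | exists2 z, S z &
  forall i, (1 <= i <= n)%N ->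
    `|ratr (nth 0 tk.1 i) - z i| + tk.2.+1%:R^-1 <= q].
have -> : [set w | exists2 z, S z &
    forall i, (1 <= i <= n)%N -> `|X i w - z i| < q] = \bigcup_(tk in I) box tk.
  apply/seteqP; split=> w; last first.
    move=> [tk [z Sz zq] wtk]; exists z => // i i1n.
    apply: le_lt_trans (ler_distD (ratr (nth 0 tk.1 i)) _ _) _.
    by apply: lt_le_trans (zq i i1n); rewrite addrC ltrD2l; exact: wtk.
  move=> [z Sz Xz].
  (* Starting the maximum at [q - 1] gives [M < q] for every [n] and every sign of [q]. *)
  pose M := \big[Num.max/(q - 1)]_(i < n) `|X i.+1 w - z i.+1|.
  have XzM i : (1 <= i <= n)%N -> `|X i w - z i| <= M.
    by case: i => [//|i] /andP[_ i_n]; exact: (le_bigmax _ _ (Ordinal i_n)).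
  have Mq : M < q.
    by apply/bigmax_ltP; split=> [|i _]; [rewrite ltrBlDr ltrDl ltr01|apply: Xz => /=].
  (* The gap [q - M] has to absorb [1 / k.+1] twice: once for the rational approximation of [X i w],
     once for the radius of the box. *)
  pose k := Num.truncn ((q - M)^-1 * 2).
  have kq : (k.+1%:R : R)^-1 * 2 < q - M.
    have qM : 0 < q - M by rewrite subr_gt0.
    rewrite ltr_pdivrMl ?ltr0n// -ltr_pdivrMr//.
    by rewrite mulrC truncnS_gt.
  have k0 : 0 < (k.+1%:R : R)^-1 by rewrite invr_gt0 ltr0n.
  have /choice[r rP] : forall i, exists r : rat,
      `|X i w - ratr r| < (k.+1%:R : R)^-1.
    move=> i; have : X i w - k.+1%:R^-1 < X i w + k.+1%:R^-1.
      by rewrite ltrBlDr -addrA ltrDl addr_gt0.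
    move=> /rat_in_itvoo[r]; rewrite in_itv/= => /andP[r1 r2]; exists r.
    by rewrite ltr_distlC r1.
  have nthr i : (1 <= i <= n)%N -> nth 0 (mkseq r n.+1) i = r i.
    by move=> /andP[_ i_n]; rewrite nth_mkseq.
  (* The length is [n.+1] because the cells are numbered from 1. *)
  exists (mkseq r n.+1, k) => /=; last by move=> i /nthr ->.
  exists z => // i i1n; rewrite nthr//.
  have := ler_distD (X i w) (ratr (r i)) (z i).
  move: kq (rP i) (XzM i i1n); rewrite (distrC (ratr _) (X i w)).
  by move: (k.+1%:R^-1) => e; lra.
rewrite bigcup_mkcond; apply: countable_bigcupT_measurable => // tk.
case: ifPn => // _.
have -> : box tk = \bigcap_(i in [set i | (1 <= i <= n)%N])
    (X i @^-1` `]ratr (nth 0 tk.1 i) - tk.2.+1%:R^-1,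
                 ratr (nth 0 tk.1 i) + tk.2.+1%:R^-1[).
  by apply/seteqP; split=> w h i i1n; have := h i i1n;
    rewrite /= in_itv/= ltr_distl.
apply: bigcap_measurableType => i i1n; rewrite -[_ @^-1` _]setTI.
exact: (mX i i1n).
Qed.

(** * Probabilities of joint events for independent standard normal variables *)

Section gaussian_noise.
Context d (T : measurableType d) (R : realType) (P : probability T R).
Variables (n : nat) (X : nat -> {RV P >-> R}).
Hypothesis indepX : mutually_independent [set i | 1 <= i <= n]%N X.
Hypothesis normalX : forall i, (1 <= i <= n)%N -> standard_normal (X i).

Lemma prob_all_in (s : seq nat) (B : set R) : uniq s ->
  {in s, forall i, (1 <= i <= n)%N} -> measurable B ->
  P [set w | forall i, i \in s -> B (X i w)] =
  (fine (normal_prob 0 1 B) ^+ size s)%:E.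
Proof.
move=> us s1n mB; pose F := [fset i in s]%fset.
have -> : [set w | forall i, i \in s -> B (X i w)] =
    \bigcap_(i in [set` F]) (X i @^-1` B).
  apply/seteqP; split=> w h i /=.
    by rewrite !inE => /h.
  by move=> si; apply: h; rewrite /= !inE.
rewrite (indepX (F := F) _ (B := fun=> B))//; last by move=> i /=; rewrite !inE => /s1n.
have pB i : i \in (F : seq nat) -> P (X i @^-1` B) = (fine (normal_prob 0 1 B))%:E.
  rewrite inE => /s1n /normalX /(_ B mB).
  rewrite fineK//; exact: (fin_num_measure (@normal_prob R 0 1)).
(* Since [s] has no repetitions, passing to a finite set loses no factor. *)
have <- : size (F : seq nat) = size s.
  by rewrite -[size _]/(#|` F|) card_fseq undup_id.
elim: (F : seq nat) pB => [|i r ih] pB; first by rewrite big_nil expr0.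
rewrite big_cons ih => [|j jr]; last by apply: pB; rewrite inE jr orbT.
by rewrite pB ?inE ?eqxx// -EFinM -exprS.
Qed.

Lemma measurable_all_in (s : seq nat) (B : set R) : measurable B ->
  measurable [set w | forall i, i \in s -> B (X i w)].
Proof.
move=> mB; have -> : [set w | forall i, i \in s -> B (X i w)] =
    \bigcap_(i in [set` s]) (X i @^-1` B) by [].
apply: bigcap_measurableType => i _.
by rewrite -[_ @^-1` _]setTI; exact: measurable_funP.
Qed.

(** With [m] the size of [s], the probability is at most [(1 - t) ^+ m <= expR (- t * m) <= 1 / (1 +
    t * m)], and [1 + 9 = 10]. *)
Lemma prob_none_in (s : seq nat) (C : set R) (t : R) : uniq s ->
  {in s, forall i, (1 <= i <= n)%N} -> measurable C ->
  (t%:E <= normal_prob 0 1 C)%E -> 9 <= t * (size s)%:R ->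
  (P [set w | forall i, i \in s -> (~` C) (X i w)] <= 10^-1%:E)%E.
Proof.
move=> us s1n mC tC ts; rewrite prob_all_in//; last exact: measurableC.
have Cfin : normal_prob 0 1 C \is a fin_num.
  exact: (fin_num_measure (@normal_prob R 0 1)).
have -> : normal_prob 0 1 (~` C) = (1 - fine (normal_prob 0 1 C))%:E.
  by rewrite EFinB fineK//; exact: (@probability_setC _ _ _ (@normal_prob R 0 1)).
rewrite lee_fin [fine _]/=.
have : 0 <= fine (normal_prob 0 1 C) <= 1.
  by rewrite -!lee_fin fineK// measure_ge0 (probability_le1 (@normal_prob R 0 1)).
move: tC; rewrite -(fineK Cfin) lee_fin /=; move: (fine _) => p /= tp /andP[p0 p1].
have m0 : 0 <= (size s)%:R :> R by [].
apply: (@le_trans _ _ (expR (- t * (size s)%:R))).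
  rewrite mulrC expRM_natl; apply: lerXn2r; rewrite ?nnegrE ?subr_ge0 ?expR_ge0//.
  by apply: le_trans _ (expR_ge1Dx _); lra.
rewrite mulNr expRN lef_pV2 ?posrE ?expR_gt0//.
by apply: le_trans _ (expR_ge1Dx _); lra.
Qed.

Lemma prob_all_bounded (b : R) : (1600 <= n)%N ->
  (normal_prob 0 1 `[b, +oo[ <= (400 / n%:R)%:E)%E ->
  ((expR (- 1600))%:E <=
    P [set w | forall i, i \in iota 1 n -> `](- b)%R, b%R[%classic (X i w)])%E.
Proof.
move=> n1600 tb; rewrite prob_all_in ?iota_uniq//; last first.
  by move=> i; rewrite mem_iota.
rewrite size_iota lee_fin.
have nR : 1600%:R <= n%:R :> R by rewrite ler_nat.
have n0 : 0 < n%:R :> R by lra.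
(* Two symmetric tails of mass at most [400 / n] each leave the interval at least [1 - x]. *)
pose x : R := 800 / n%:R.
have x2 : 0 <= x <= 2^-1.
  by apply/andP; split; rewrite /x; [apply: divr_ge0; lra|rewrite ler_pdivrMr//; lra].
have px : 1 - x <= fine (normal_prob 0 1 `]- b, b[).
  set p := fine _.
  have fin (D : set R) : measurable D -> normal_prob 0 1 D \is a fin_num.
    by move=> mD; exact: (fin_num_measure (@normal_prob R 0 1)).
  pose A : set R := `]-oo, - b]%classic; pose B : set R := `[b, +oo[%classic.
  pose C : set R := `]- b, b[%classic.
  have [mA mB mC] : [/\ measurable A, measurable B & measurable C] by split; exact: measurable_itv.
  have : (1 <= normal_prob 0 1 A + normal_prob 0 1 B + normal_prob 0 1 C)%E.
    rewrite -(@probability_setT _ _ _ (@normal_prob R 0 1)).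
    have -> : [set: R] = (A `|` B) `|` C.
      apply/esym; rewrite -subTset => y _ /=; rewrite /A /B /C /= !in_itv/= andbT.
      by case: (leP y (- b)) => [|h1]; [left; left|case: (leP b y); [left; right|right]].
    apply: le_trans (measureU2 _ _ _) _ => //; first exact: measurableU.
    by apply: leeD => //; exact: measureU2.
  rewrite /A normal_prob_reflect -/B -(fineK (fin C mC)) -/p.
  move: tb; rewrite -/B -(fineK (fin B mB)).
  rewrite -!EFinD !lee_fin /x; lra.
(* For [0 <= x <= 1 / 2] one has [(1 - x) * (1 + 2 * x) >= 1]. The [n]-th power of this bound is
   [expR (- 1600)]. *)
have : expR (- (2 * x)) <= 1 - x.
  rewrite expRN; apply: (@le_trans _ _ (1 + 2 * x)^-1).
    by rewrite lef_pV2 ?posrE ?expR_gt0 ?expR_ge1Dx//; lra.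
  rewrite -[leLHS]mul1r ler_pdivrMr; nra.
move=> h; have -> : - 1600 = n%:R * - (2 * x) :> R.
  by rewrite mulrN mulrCA [_ * x]mulrC divfK ?gt_eqF//; lra.
rewrite expRM_natl; apply: lerXn2r; rewrite ?nnegrE ?expR_ge0//; last exact: le_trans px.
by apply: le_trans px; apply: le_trans h; exact: expR_ge0.
Qed.

End gaussian_noise.

(** * The event of exactly one mode for a fixed sample size *)

Section fixed_sample_size.
Context d (T : measurableType d) (R : realType) (P : probability T R).
Variables (n : nat) (eps : nat -> {RV P >-> R}) (delta q : R).
Hypothesis indep_eps : mutually_independent [set i | 1 <= i <= n]%N eps.
Hypothesis normal_eps : forall i, (1 <= i <= n)%N -> standard_normal (eps i).

Let Y w i : R := bump_signal delta (i%:R / n%:R) + eps i w.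

Let one_mode := [set w | mode_count n q (step_fun n (Y w)) = 1%E].

(** The event is a difference of two sets of samples within [q] of some admissible vector of cell
    values, both covered by [measurable_sup_nbhs]. *)
Lemma measurable_one_mode : (0 < n)%N -> measurable one_mode.
Proof.
move=> n0; pose S j := [set z | exists2 h : R -> R, has_steps n z h &
  (modes h <= j%:R%:E)%E].
pose close j := [set w | exists2 z, S j z &
  forall i, (1 <= i <= n)%N -> `|Y w i - z i| < q].
have mclose j : measurable (close j).
  apply: (@measurable_sup_nbhs _ _ _ (fun i w => Y w i)) => i i1n.
  by apply: measurable_funD => //; exact: measurable_cst.
have -> : one_mode = ~` close 0%N `&` close 1%N.
  apply/seteqP; split=> w /=.
    by move=> /mode_count_eq1[/(signature_lt _ _ _ n0) ? /(signature_lt _ _ _ n0)].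
  move=> h; apply/mode_count_eq1.
  by split; [move=> /(signature_lt _ _ _ n0)|apply/(signature_lt _ _ _ n0)]; case: h.
by apply: measurableI => //; exact: measurableC.
Qed.

Hypothesis delta_gt0 : 0 < delta.

Let bump_itv x : 0 <= bump_signal delta x <= delta.
Proof. by rewrite /bump_signal; case: ifP => _; rewrite ?lexx ?ltW. Qed.

(** The signal stays within [delta / 2] of the constant [delta / 2], so noise in []-b, b[] keeps the
    data closer than [b + delta / 2 <= q] to a function without modes. *)
Lemma one_mode_noise_range (b : R) w : (0 < n)%N -> 2 * b + delta <= 2 * q ->
  one_mode w -> ~ (forall i, i \in iota 1 n -> `](- b), b[%classic (eps i w)).
Proof.
move=> n0 bq /mode_count_eq1[+ _] wb; apply.
apply/(signature_lt _ _ _ n0); exists (fun=> delta / 2).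
  by exists (fun=> delta / 2); [exact: has_steps_cst|rewrite modes_cst].
move=> i i1n; have := wb i; rewrite mem_iota add1n ltnS => /(_ i1n).
rewrite /= in_itv/= => /andP[eb1 eb2]; rewrite ltr_distl /Y.
by have /andP[y0 y1] := bump_itv (i%:R / n%:R); apply/andP; split; lra.
Qed.

(** The five blocks are [c = 0, ..., 4]; even ones will supply low values and odd ones high values.
    The successor reflects the numbering of cells from 1. *)
Let block c := iota (c * (n %/ 5)).+1 (n %/ 5).

(** Otherwise a function with values [z] closer than [q] to the data is below [q + delta - l]
    somewhere in each even block and above [l - q] somewhere in each odd one. The hypothesis says
    [q + delta - l <= l - q], so two modes appear. *)
Lemma one_mode_noise_blocks (l : R) w : (0 < n)%N -> 2 * q + delta <= 2 * l ->
  one_mode w ->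
  (exists2 c, (c <= 2)%N &
    forall i, i \in block (2 * c) -> (~` `]-oo, - l]) (eps i w)) \/
  (exists2 c, (c <= 1)%N &
    forall i, i \in block (2 * c).+1 -> (~` `[l, +oo[) (eps i w)).
Proof.
move=> n0 ql /mode_count_eq1[_ /(signature_lt _ _ _ n0)[z [h zh h1] Yz]].
apply: contrapT => /not_orP[lo hi].
have block_le c i : (c <= 4)%N -> i \in block c ->
    (c * (n %/ 5) < i <= c.+1 * (n %/ 5))%N /\ (1 <= i <= n)%N.
  rewrite /block mem_iota => c4 ic; have := leq_trunc_div n 5.
  nia.
have zlo c : (c <= 2)%N -> exists2 i, i \in block (2 * c) & z i < q + delta - l.
  move=> c2; have c4 : (2 * c <= 4)%N by lia.
  apply: contrapT => nlo; apply: lo; exists c => // i ic /=.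
  rewrite in_itv/= => eil; apply: nlo; exists i => //.
  have [_ i1n] := block_le _ _ c4 ic.
  have := Yz i i1n; rewrite ltr_distlC => /andP[_]; rewrite /Y.
  by have /andP[_ y1] := bump_itv (i%:R / n%:R); lra.
have zhi c : (c <= 1)%N -> exists2 i, i \in block (2 * c).+1 & l - q < z i.
  move=> c1; have c4 : ((2 * c).+1 <= 4)%N by lia.
  apply: contrapT => nhi; apply: hi; exists c => // i ic /=.
  rewrite in_itv/= andbT => eil; apply: nhi; exists i => //.
  have [_ i1n] := block_le _ _ c4 ic.
  have := Yz i i1n; rewrite ltr_distlC => /andP[+ _]; rewrite /Y.
  by have /andP[y0 _] := bump_itv (i%:R / n%:R); lra.
have [i1 /block_le-/(_ isT)[b1 r1] z1] := zlo 0%N isT.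
have [i3 /block_le-/(_ isT)[b3 r3] z3] := zlo 1%N isT.
have [i5 /block_le-/(_ isT)[b5 r5] z5] := zlo 2%N isT.
have [i2 /block_le-/(_ isT)[b2 r2] z2] := zhi 0%N isT.
have [i4 /block_le-/(_ isT)[b4 r4] z4] := zhi 1%N isT.
have : (2%:R%:E <= modes h)%E.
  apply: (modes_two (i1 := i1) (i2 := i2) (i3 := i3) (i4 := i4) (i5 := i5) zh);
    rewrite ?gt_max; try lia.
  - by apply/andP; split; lra.
  - by apply/andP; split; lra.
by move=> /le_trans/(_ h1); rewrite lee_fin; lra.
Qed.

Lemma prob_one_mode_le : (1600 <= n)%N ->
  delta * Num.sqrt (ln n%:R) <= 100^-1 ->
  (P one_mode <= (1 - expR (- 1600))%:E)%E.
Proof.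
move=> n1600 dn; have n0 : (0 < n)%N by exact: leq_trans n1600.
have mE := measurable_one_mode n0.
have n800 : (800 < n)%N by exact: leq_trans n1600.
have [b [tb tl]] := normal_level n800 delta_gt0 dn.
have [bq|bq] := leP (2 * b + delta) (2 * q).
  pose G := [set w | forall i, i \in iota 1 n -> `](- b), b[%classic (eps i w)].
  have mG : measurable G by apply: measurable_all_in.
  apply: (@le_trans _ _ (P (~` G))).
    apply: le_measure; [exact: mem_set|exact/mem_set/measurableC|].
    by move=> w /(one_mode_noise_range n0 bq).
  rewrite probability_setC// EFinB; apply: leeB => //.
  exact: (prob_all_bounded indep_eps normal_eps n1600 tb).
(* This is the shifted level at which [normal_level] still guarantees tail mass [180 / n]. *)
pose l := b + 2 * delta; have ql : 2 * q + delta <= 2 * l.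
  by have := delta_gt0; rewrite /l; lra.
pose L c := [set w | forall i, i \in block (2 * c) -> (~` `]-oo, - l]) (eps i w)].
pose H c := [set w | forall i, i \in block (2 * c).+1 -> (~` `[l, +oo[) (eps i w)].
have mL c : measurable (L c) by apply: measurable_all_in; exact: measurableC.
have mH c : measurable (H c) by apply: measurable_all_in; exact: measurableC.
have block_in c : (c <= 4)%N -> {in block c, forall i, (1 <= i <= n)%N}.
  move=> c4 i; rewrite mem_iota; have := leq_trunc_div n 5; nia.
(* Despite rounding, each block contains at least [n / 20] cells, and [180 / 20 = 9]. *)
have sz c : 9 <= 180 / n%:R * (size (block c))%:R :> R.
  have n0R : 0 < n%:R :> R by rewrite ltr0n.
  rewrite size_iota mulrAC ler_pdivlMr//.
  have : (9 * n <= 180 * (n %/ 5))%N by lia.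
  by rewrite -(ler_nat R) !natrM.
have PL c : (c <= 2)%N -> (P (L c) <= 10^-1%:E)%E.
  move=> c2; apply: (@prob_none_in _ _ _ _ _ _ indep_eps normal_eps _ _ (180 / n%:R)) => //.
  - exact: iota_uniq.
  - by apply: block_in; lia.
  - by rewrite normal_prob_reflect.
have PH c : (c <= 1)%N -> (P (H c) <= 10^-1%:E)%E.
  move=> c1; apply: (@prob_none_in _ _ _ _ _ _ indep_eps normal_eps _ _ (180 / n%:R)) => //.
  - exact: iota_uniq.
  - by apply: block_in; lia.
apply: (@le_trans _ _ (P (L 0 `|` (L 1 `|` (L 2 `|` (H 0 `|` H 1)))))).
  apply: le_measure; [exact: mem_set|apply: mem_set|].
    by do 4?[apply: measurableU => //].
  move=> w /(one_mode_noise_blocks n0 ql)[[[|[|[|//]]] _ h]|[[|[|//]] _ h]].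
  - by left.
  - by right; left.
  - by right; right; left.
  - by right; right; right; left.
  - by right; right; right; right.
have e2 : expR (- 1600) <= 2^-1 :> R.
  rewrite expRN lef_pV2 ?posrE ?expR_gt0//; apply: le_trans _ (expR_ge1Dx _); lra.
have PU A B p r : measurable A -> measurable B ->
    (P A <= p -> P B <= r -> P (A `|` B) <= p + r)%E.
  by move=> mA mB pA pB; apply: le_trans (measureU2 _ mA mB) _; exact: leeD.
(* Union bound: five failures of probability at most 1/10 add up to 1/2, which is at most
   [1 - expR (- 1600)] by [e2]. *)
apply: (@le_trans _ _ (10^-1%:E + (10^-1%:E + (10^-1%:E + (10^-1%:E + 10^-1%:E))))%E).
  do 3?[apply: (@PU); [exact: mL|by do 3?[apply: measurableU => //]|exact: PL|]].
  by apply: (@PU) => //; exact: PH.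
by rewrite -!EFinD lee_fin; lra.
Qed.

End fixed_sample_size.

Theorem theorem7 (R : realType) (delta : nat -> R)
    (delta_gt0 : forall n, (1 <= n)%N -> 0 < delta n)
    (delta_small : delta n * Num.sqrt (ln n%:R) @[n --> \oo] --> (0 : R))
    (d : nat -> measure_display) (T : forall n, measurableType (d n))
    (P : forall n, probability (T n) R)
    (eps : forall n, nat -> {RV P n >-> R})
    (eps_indep : forall n, mutually_independent [set i | 1 <= i <= n]%N (eps n))
    (eps_normal : forall n i, (1 <= i <= n)%N -> standard_normal (eps n i))
    (q : nat -> R) :
  let Y n (w : T n) (i : nat) : R :=
    bump_signal (delta n) (i%:R / n%:R) + eps n i w in
  (limn_esup (fun n =>
     P n [set w | mode_count n (q n) (step_fun n (Y n w)) = 1%E]) < 1)%E.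
Proof.
cbv zeta; set u := (X in limn_esup X).
(* The bound does not depend on [q n], which is why an arbitrary sequence of thresholds is
   allowed. *)
have [N _ uN] : \forall n \near \oo, (u n <= (1 - expR (- 1600))%:E)%E.
  near=> n.
  have n1600 : (1600 <= n)%N by near: n; exact: nbhs_infty_ge.
  apply: (prob_one_mode_le (q n) (eps_indep n) (@eps_normal n)) => //.
    by apply: delta_gt0; exact: leq_trans n1600.
  apply/ltW; near: n; apply: (cvgr_lt _ delta_small).
  by rewrite invr_gt0.
apply: (@le_lt_trans _ _ (1 - expR (- 1600))%:E); last first.
  by rewrite lte_fin gtrBl expR_gt0.
(* The limit superior is the limit of the suprema over [k >= m], and these obey the bound once
   [m >= N]. *)
rewrite limn_esup_lim; apply: lime_le; first exact: is_cvg_esups.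
exists N => // m /= Nm; apply: ge_ereal_sup => _ [k /= mk <-].
by apply: uN => /=; exact: leq_trans mk.
Unshelve. all: by end_near.
Qed.
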